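(* Consider a semi-explicit index-1 DAE (SE-DAE) with matrices $(E,A,B,C,D)$ and underlying ODE $(E_1,A_1,B_1,C_1,D_1)$ as defined in the context, and assume it is in strictly dissipative form, i.e. $E_1=E_1^\top\succ0$ and $A_1+A_1^\top\prec0$. Assume further that either (i) $B_{22}=0$, or (ii) $A_{22}=A_{22}^\top$, $A_{12}=A_{21}^\top$, $C_{22}=B_{22}^\top$. Let $S_V\in\mathbb{R}^{n\times n}$, $R\in\mathbb{R}^{m\times n}$, let $V=\begin{bmatrix} V_1 \\ V_2 \end{bmatrix}\in\mathbb{R}^{N\times n}$ (with $V_1\in\mathbb{R}^{n_{dyn}\times n}$) have full column rank and satisfy $$AV-EVS_V-BR=0,$$ and assume $V^\top EV$ is nonsingular. Put $D_{imp}=-C_{22}A_{22}^{-1}B_{22}$, set $L=0$ in case (i) and $L=R^\top$ in case (ii), and define the reduced order model obtained by orthogonal projection by $$E_r=V^\top EV,\quad A_r=V^\top AV+L D_{imp}R,\quad B_r=V^\top B+L D_{imp},\quad C_r=CV+D_{imp}R,\quad D_r=D+D_{imp}.$$ Then this reduced order model is asymptotically stable (all generalized eigenvalues of the pair $(A_r,E_r)$ have strictly negative real part), and it implicitly reduces the underlying ODE, i.e. $$E_r=V_1^\top E_1V_1,\quad A_r=V_1^\top A_1V_1,\quad B_r=V_1^\top B_1,\quad C_r=C_1V_1,\quad D_r=D_1 .$$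
   Context: An SE-DAE is a system $E\dot x = Ax+Bu$, $y=Cx+Du$ with real matrices, $x(t)\in\mathbb{R}^N$, $u(t)\in\mathbb{R}^m$, $y(t)\in\mathbb{R}^p$, partitioned as $$E=\begin{bmatrix} E_{11} & 0 \\ 0 & 0 \end{bmatrix},\quad A=\begin{bmatrix} A_{11} & A_{12} \\ A_{21} & A_{22} \end{bmatrix},\quad B=\begin{bmatrix} B_{11} \\ B_{22} \end{bmatrix},\quad C=[C_{11},\,C_{22}],$$ where $E_{11}\in\mathbb{R}^{n_{dyn}\times n_{dyn}}$, $\det E_{11}\neq0$, $\det A_{22}\neq 0$ and all blocks are partitioned conformally. Its underlying ODE is $E_1\dot x_1=A_1x_1+B_1u$, $y=C_1x_1+D_1u$ with $$E_1=E_{11},\quad A_1=A_{11}-A_{12}A_{22}^{-1}A_{21},\quad B_1=B_{11}-A_{12}A_{22}^{-1}B_{22},\quad C_1=C_{11}-C_{22}A_{22}^{-1}A_{21},\quad D_1=D-C_{22}A_{22}^{-1}B_{22}.$$ $\succ0$ ($\prec0$) denotes positive (negative) definiteness of symmetric matrices. In case (ii), $p=m$ is implicit. The generalized eigenvalues of $(A_r,E_r)$ are the $\lambda\in\mathbb{C}$ with $\det(A_r-\lambda E_r)=0$. *)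

(* Defs.v *)
From mathcomp Require Import all_boot all_order all_algebra.
From mathcomp Require Import reals.
From mathcomp.real_closed Require Import complex.

Set Implicit Arguments.
Unset Strict Implicit.
Unset Printing Implicit Defensive.

Import Order.TTheory GRing.Theory Num.Theory.

Local Open Scope ring_scope.

Section Definiteness.
Variable (K : realType).

Definition posdef n (M : 'M[K]_n) : Prop :=
  M^T = M /\ forall x : 'cV[K]_n, x != 0 -> 0 < (x^T *m M *m x) 0 0.

Definition negdef n (M : 'M[K]_n) : Prop :=
  M^T = M /\ forall x : 'cV[K]_n, x != 0 -> (x^T *m M *m x) 0 0 < 0.

Definition generalized_eigenvalue n (A E : 'M[K]_n) (lambda : K[i]) : Prop :=
  \det (map_mx (real_complex K) A - lambda *: map_mx (real_complex K) E) = 0.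

End Definiteness.

(* E x' = A x + B u, y = C x + D u, with state dimension N, m inputs and
   p outputs. *)
Record descriptor_system (K : realType) (N m p : nat) := DescriptorSystem {
  sysE : 'M[K]_N;
  sysA : 'M[K]_N;
  sysB : 'M[K]_(N, m);
  sysC : 'M[K]_(p, N);
  sysD : 'M[K]_(p, m)
}.

Definition strictly_dissipative (K : realType) N m p
    (S : descriptor_system K N m p) : Prop :=
  posdef (sysE S) /\ negdef (sysA S + (sysA S)^T).

Definition asymptotically_stable (K : realType) N m p
    (S : descriptor_system K N m p) : Prop :=
  forall lambda : K[i],
    generalized_eigenvalue (sysA S) (sysE S) lambda -> complex.Re lambda < 0.

(* The total state dimension is N = n1 + n2, with n1 = n_dyn. *)
Record se_dae (K : realType) (n1 n2 m p : nat) := SeDae {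
  E11 : 'M[K]_n1;
  A11 : 'M[K]_n1;
  A12 : 'M[K]_(n1, n2);
  A21 : 'M[K]_(n2, n1);
  A22 : 'M[K]_n2;
  B11 : 'M[K]_(n1, m);
  B22 : 'M[K]_(n2, m);
  C11 : 'M[K]_(p, n1);
  C22 : 'M[K]_(p, n2);
  Dft : 'M[K]_(p, m);
  det_E11_neq0 : \det E11 != 0;
  det_A22_neq0 : \det A22 != 0
}.

Section SeDaeTheory.
Variables (K : realType) (n1 n2 m p : nat) (S : se_dae K n1 n2 m p).

Definition se_dae_system : descriptor_system K (n1 + n2) m p :=
  {| sysE := block_mx (E11 S) 0 0 0;
     sysA := block_mx (A11 S) (A12 S) (A21 S) (A22 S);
     sysB := col_mx (B11 S) (B22 S);
     sysC := row_mx (C11 S) (C22 S);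
     sysD := Dft S |}.

Definition underlying_ode : descriptor_system K n1 m p :=
  {| sysE := E11 S;
     sysA := A11 S - A12 S *m invmx (A22 S) *m A21 S;
     sysB := B11 S - A12 S *m invmx (A22 S) *m B22 S;
     sysC := C11 S - C22 S *m invmx (A22 S) *m A21 S;
     sysD := Dft S - C22 S *m invmx (A22 S) *m B22 S |}.

Definition Dimp : 'M[K]_(p, m) := - (C22 S *m invmx (A22 S) *m B22 S).

Definition case_i n (L : 'M[K]_(n, p)) : Prop := B22 S = 0 /\ L = 0.

(* C22 = B22^T and L = R^T only make sense when p = m, so the case provides
   this equality and the equations are stated along it. *)
Definition case_ii n (R : 'M[K]_(m, n)) (L : 'M[K]_(n, p)) : Prop :=
  [/\ A22 S = (A22 S)^T, A12 S = (A21 S)^T &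
      exists epm : p = m,
        castmx (epm, erefl n2) (C22 S) = (B22 S)^T /\
        castmx (erefl n, epm) L = R^T].

Definition reduced_model n (V : 'M[K]_(n1 + n2, n)) (R : 'M[K]_(m, n))
    (L : 'M[K]_(n, p)) : descriptor_system K n m p :=
  {| sysE := V^T *m sysE se_dae_system *m V;
     sysA := V^T *m sysA se_dae_system *m V + L *m Dimp *m R;
     sysB := V^T *m sysB se_dae_system + L *m Dimp;
     sysC := sysC se_dae_system *m V + Dimp *m R;
     sysD := sysD se_dae_system + Dimp |}.

End SeDaeTheory.

(* Main.v *)
(* The algebraic block row of the Sylvester equation determines
   [V2 = A22^-1 (B22 R - A21 V1)]; substituting it into the projected matrices
   gives those of the projected underlying ODE, the feedthrough [L Dimp]
   cancelling what the symmetry of the algebraic part leaves over.  A congruence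
   by the injective matrix [V1] preserves strict dissipativity.  Finally, if
   [v (A - lambda E) = 0] with [v = a + i b], then the real part of
   [v (A - lambda E) v^*] is
   [a A a^T + b A b^T - Re lambda (a E a^T + b E b^T)], which forces
   [Re lambda < 0]. *)
Require Import Defs.
From mathcomp Require Import all_boot all_order all_algebra.
From mathcomp Require Import reals.
From mathcomp.real_closed Require Import complex.
From mathcomp Require Import lra.

Import Order.TTheory GRing.Theory Num.Theory.
Local Open Scope ring_scope.

Lemma map_mx_Re_real_mul (K : rcfType) (q n r : nat) (A : 'M[K[i]]_(q, n))
    (B : 'M[K]_(n, r)) :
  map_mx (@complex.Re K) (A *m map_mx (real_complex K) B)
  = map_mx (@complex.Re K) A *m B.
Proof.
apply/matrixP=> i j; rewrite !mxE raddf_sum; apply: eq_bigr => k _.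
by rewrite !mxE; case: (A i k) => x y /=; rewrite mulr0 subr0.
Qed.

Lemma map_mx_Im_real_mul (K : rcfType) (q n r : nat) (A : 'M[K[i]]_(q, n))
    (B : 'M[K]_(n, r)) :
  map_mx (@complex.Im K) (A *m map_mx (real_complex K) B)
  = map_mx (@complex.Im K) A *m B.
Proof.
apply/matrixP=> i j; rewrite !mxE raddf_sum; apply: eq_bigr => k _.
by rewrite !mxE; case: (A i k) => x y /=; rewrite mulr0 add0r.
Qed.

(** A singular pencil has a nonzero left null vector [v]. Splitting [v = a + i b] yields two
    equations over [K], the field in which definiteness is stated. *)
Lemma generalized_eigenvector (K : realType) (n : nat) (A E : 'M[K]_n)
    (lambda : K[i]) :
  generalized_eigenvalue A E lambda ->
  exists a b : 'rV[K]_n,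
    [/\ (a != 0) || (b != 0),
        a *m A = (complex.Re lambda *: a - complex.Im lambda *: b) *m E &
        b *m A = (complex.Re lambda *: b + complex.Im lambda *: a) *m E].
Proof.
move=> /eqP/det0P[v v_neq0]; rewrite mulmxBr -scalemxAr => /eqP.
rewrite subr_eq0 scalemxAl => /eqP vA.
exists (map_mx (@complex.Re K) v), (map_mx (@complex.Im K) v); split.
- apply: contraNT v_neq0; rewrite negb_or !negbK => /andP[/eqP v_re /eqP v_im].
  apply/eqP/matrixP=> i j; rewrite mxE; apply/eqP.
  move/matrixP/(_ i j): v_re; move/matrixP/(_ i j): v_im; rewrite !mxE.
  by case: (v i j) => x y /= -> ->.
- rewrite -map_mx_Re_real_mul vA map_mx_Re_real_mul; congr (_ *m _).
  apply/matrixP=> i j; rewrite !mxE.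
  by case: lambda (v i j) {vA} => s t [].
- rewrite -map_mx_Im_real_mul vA map_mx_Im_real_mul; congr (_ *m _).
  apply/matrixP=> i j; rewrite !mxE.
  by case: lambda (v i j) {vA} => s t [].
Qed.

(** A 1 by 1 matrix is its own transpose. This turns negativity of [A + A^T] into a sign for the
    quadratic form of [A] itself. *)
Lemma quad_form_symmetrization (K : comNzRingType) (n : nat) (M : 'M[K]_n)
    (x : 'cV[K]_n) :
  (x^T *m (M + M^T) *m x) 0 0 = (x^T *m M *m x) 0 0 *+ 2.
Proof.
rewrite mulmxDr mulmxDl mxE mulr2n; congr (_ + _).
have -> : x^T *m M^T *m x = (x^T *m M *m x)^T by rewrite !trmx_mul trmxK mulmxA.
by rewrite mxE.
Qed.

Lemma strictly_dissipative_stable (K : realType) (N m p : nat)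
    (S : descriptor_system K N m p) :
  strictly_dissipative S -> asymptotically_stable S.
Proof.
case=> [[E_sym E_pos] [_ A_neg]] lambda /generalized_eigenvector[a [b]].
set A := sysA S in A_neg *; set E := sysE S in E_sym E_pos *.
set s := complex.Re lambda; set t := complex.Im lambda => -[ab_neq0 aA bA].
pose e (x y : 'rV[K]_N) := (x *m E *m y^T) 0 0.
pose d (x : 'rV[K]_N) := (x *m A *m x^T) 0 0.
have e_pos x : x != 0 -> 0 < e x x.
  by move=> x_neq0; rewrite -[X in e X _]trmxK; apply: E_pos; rewrite trmx_eq0.
have d_neg x : x != 0 -> d x < 0.
  move=> x_neq0; have := A_neg x^T; rewrite quad_form_symmetrization trmxK -/(d x).
  by rewrite trmx_eq0 pmulrn_llt0 //; apply.
have e0 : e 0 0 = 0 by rewrite /e !mul0mx mxE.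
have d0 : d 0 = 0 by rewrite /d !mul0mx mxE.
(* Symmetry of [E] makes the cross terms in [Im lambda] cancel in [d a + d b]. *)
have eC : e a b = e b a.
  by rewrite /e -[a *m E *m b^T]trmxK mxE !trmx_mul trmxK E_sym mulmxA.
have da : d a = s * e a a - t * e b a.
  rewrite /d aA !mulmxBl -!scalemxAl /e.
  by move: (_ *m a^T) (_ *m a^T) => P Q; rewrite !mxE.
have db : d b = s * e b b + t * e a b.
  rewrite /d bA !mulmxDl -!scalemxAl /e.
  by move: (_ *m b^T) (_ *m b^T) => P Q; rewrite !mxE.
have sum_eq : d a + d b = s * (e a a + e b b) by rewrite da db eC; lra.
have e_ge0 x : 0 <= e x x.
  by have [->|/e_pos/ltW//] := eqVneq x 0; rewrite e0.
have d_le0 x : d x <= 0.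
  by have [->|/d_neg/ltW//] := eqVneq x 0; rewrite d0.
(* Only one of [a], [b] is known to be nonzero: it gives the strict inequalities, the other one the
   weak ones. *)
have [sum_e sum_d] : 0 < e a a + e b b /\ d a + d b < 0.
  case/orP: ab_neq0 => nz; have := e_pos _ nz; have := d_neg _ nz.
    by have := e_ge0 b; have := d_le0 b; lra.
  by have := e_ge0 a; have := d_le0 a; lra.
by move: sum_d; rewrite sum_eq pmulr_llt0.
Qed.

Lemma posdef_congr (K : realType) (q n : nat) (M : 'M[K]_q) (W : 'M[K]_(q, n)) :
  (forall x : 'cV[K]_n, W *m x = 0 -> x = 0) -> posdef M ->
  posdef (W^T *m M *m W).
Proof.
move=> W_inj [M_sym M_pos]; split; first by rewrite !trmx_mul trmxK M_sym mulmxA.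
move=> x x_neq0; have := M_pos (W *m x); rewrite trmx_mul !mulmxA; apply.
by apply: contraNneq x_neq0 => /W_inj ->.
Qed.

Lemma negdef_congr (K : realType) (q n : nat) (M : 'M[K]_q) (W : 'M[K]_(q, n)) :
  (forall x : 'cV[K]_n, W *m x = 0 -> x = 0) -> negdef M ->
  negdef (W^T *m M *m W).
Proof.
move=> W_inj [M_sym M_neg]; split; first by rewrite !trmx_mul trmxK M_sym mulmxA.
move=> x x_neq0; have := M_neg (W *m x); rewrite trmx_mul !mulmxA; apply.
by apply: contraNneq x_neq0 => /W_inj ->.
Qed.

(** The lower block row of [E] vanishes, so [SV] drops out there. *)
Lemma sylvester_algebraic_part (K : realType) (n1 n2 m p n : nat)
    (S : se_dae K n1 n2 m p) (SV : 'M[K]_n) (R : 'M[K]_(m, n))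
    (V : 'M[K]_(n1 + n2, n)) :
  sysA (se_dae_system S) *m V - sysE (se_dae_system S) *m V *m SV
    - sysB (se_dae_system S) *m R = 0 ->
  A21 S *m usubmx V + A22 S *m dsubmx V = B22 S *m R.
Proof.
move/(congr1 dsubmx); rewrite /= -[V]vsubmxK !mul_block_col !mul_col_mx.
rewrite !(opp_col_mx, add_col_mx) !col_mxKd col_mxKu !mul0mx addr0 mul0mx subr0.
by rewrite linear0 => /eqP; rewrite subr_eq0 => /eqP.
Qed.

(* [L] is chosen so that both cases give the same projected input matrix. *)
Lemma projected_algebraic_input (K : realType) (n1 n2 m p n : nat)
    (S : se_dae K n1 n2 m p) (R : 'M[K]_(m, n)) (L : 'M[K]_(n, p))
    (V1 : 'M[K]_(n1, n)) (V2 : 'M[K]_(n2, n)) :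
  case_i S L \/ case_ii S R L ->
  A21 S *m V1 + A22 S *m V2 = B22 S *m R ->
  V2^T *m B22 S + L *m Dimp S = - (V1^T *m A12 S *m invmx (A22 S) *m B22 S).
Proof.
move=> cases alg.
have A22_unit : A22 S \in unitmx by rewrite unitmxE unitfE det_A22_neq0.
case: cases => [[B0 ->]|[A22_sym A12_tr [epm]]].
  by rewrite B0 !mulmx0 mul0mx oppr0 addr0.
subst m; rewrite !castmx_id => -[C_tr ->]; rewrite /Dimp.
(* Transpose the algebraic equation and use the symmetries. The term in [R^T *m C22 S] is then
   exactly what [R^T *m Dimp S] cancels. *)
have -> : V2^T = (R^T *m C22 S - V1^T *m A12 S) *m invmx (A22 S).
  have /(congr1 trmx) : A22 S *m V2 = B22 S *m R - A21 S *m V1.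
    by rewrite -alg addrC addKr.
  rewrite linearB /= !trmx_mul -A22_sym -A12_tr -C_tr => <-.
  by rewrite mulmxK.
by rewrite !mulmxBl mulmxN !mulmxA addrAC subrr add0r.
Qed.

Theorem theorem3p2 (K : realType) (n1 n2 m p n : nat)
    (S : se_dae K n1 n2 m p)
    (SV : 'M[K]_n) (R : 'M[K]_(m, n)) (L : 'M[K]_(n, p))
    (V : 'M[K]_(n1 + n2, n))
    (dissipS : strictly_dissipative (underlying_ode S))
    (casesS : case_i S L \/ case_ii S R L)
    (rankV : \rank V = n)
    (sylvester : sysA (se_dae_system S) *m V
                 - sysE (se_dae_system S) *m V *m SV
                 - sysB (se_dae_system S) *m R = 0)
    (unitVEV : V^T *m sysE (se_dae_system S) *m V \in unitmx) :
  let ode := underlying_ode S in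
  let rom := reduced_model S V R L in
  let V1 := usubmx V in
  asymptotically_stable rom /\
  [/\ sysE rom = V1^T *m sysE ode *m V1,
      sysA rom = V1^T *m sysA ode *m V1,
      sysB rom = V1^T *m sysB ode,
      sysC rom = sysC ode *m V1
    & sysD rom = sysD ode].
Proof.
move=> ode rom V1.
have A22_unit : A22 S \in unitmx by rewrite unitmxE unitfE det_A22_neq0.
have alg := sylvester_algebraic_part _ _ _ _ _ _ _ _ _ _ sylvester.
have input := projected_algebraic_input _ _ _ _ _ _ _ _ _ _ _ casesS alg.
have V2E : dsubmx V = invmx (A22 S) *m (B22 S *m R - A21 S *m V1).
  by rewrite -alg addrC addKr mulKmx.
have E_rom : sysE rom = V1^T *m sysE ode *m V1.
  rewrite /= -{1 2}[V]vsubmxK tr_col_mx mul_row_block mul_row_col.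
  by rewrite !mulmx0 !addr0 mul0mx addr0.
have A_rom : sysA rom = V1^T *m sysA ode *m V1.
  (* Forming [A V] first turns its lower block into [B22 R], so that [V2^T B22 + L Dimp] factors out
     on the left of [R] and [input] applies. *)
  rewrite /= -{1 2}[V]vsubmxK tr_col_mx -mulmxA mul_block_col mul_row_col alg.
  rewrite mulmxA -addrA -mulmxDl input V2E.
  rewrite !(mulmxDr, mulmxDl, mulmxN, mulNmx, mulmxA) -!addrA; congr (_ + _).
  by rewrite addrCA subrr addr0.
have B_rom : sysB rom = V1^T *m sysB ode.
  rewrite /= -{1}[V]vsubmxK tr_col_mx mul_row_col -addrA input.
  by rewrite mulmxBr !mulmxA.
have C_rom : sysC rom = sysC ode *m V1.
  (* The part of [C22 V2] containing [R] is [- Dimp R]. *)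
  rewrite /= -{1}[V]vsubmxK mul_row_col V2E /Dimp.
  rewrite !(mulmxDr, mulmxDl, mulmxN, mulNmx, mulmxA) -!addrA; congr (_ + _).
  by rewrite addrCA subrr addr0.
split; last by split.
(* The invertible matrix [V^T E V] equals [V1^T E11 V1], so it kills every [x] with [V1 x = 0]. *)
have V1_inj (x : 'cV[K]_n) : V1 *m x = 0 -> x = 0.
  move=> V1x0; rewrite -(mulKmx unitVEV x) [_ *m _ *m V]E_rom.
  by rewrite -(mulmxA _ V1 x) V1x0 !mulmx0.
apply: strictly_dissipative_stable; case: dissipS => E_pos A_neg; split.
  by rewrite E_rom; apply: posdef_congr.
have -> : sysA rom + (sysA rom)^T = V1^T *m (sysA ode + (sysA ode)^T) *m V1.
  rewrite A_rom; move: (sysA ode) => M.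
  by rewrite mulmxDr mulmxDl !trmx_mul trmxK !mulmxA.
exact: negdef_congr.
Qed.
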